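(* Let $A$ be a real $n \times n$ matrix which is a $P$-matrix and such that $(DA)^2$ is a $Q$-matrix for every positive diagonal matrix $D$. Then $-A$ is relatively $D$-stable with $\theta = \frac{\pi}{2} - \frac{\pi}{2n}$.
   Context: A real $n\times n$ matrix is called a $P$-matrix if all its principal minors are positive, and a $Q$-matrix if for every $k = 1,\ldots,n$ the sum of all its principal minors of order $k$ is positive. A positive diagonal matrix is a diagonal matrix with all diagonal entries $>0$. For $0 < \theta < \frac{\pi}{2}$ let $\mathbb{C}^0_{\theta} = \{z = x+iy \in \mathbb{C} : x < 0,\ x\tan\theta < y < -x\tan\theta\}$; for $\theta = 0$, $\mathbb{C}^0_0$ denotes the negative real half-axis $(-\infty,0)$. For a given $\theta$, a real $n\times n$ matrix $M$ is called relatively $D$-stable if all eigenvalues of $DM$ lie in $\mathbb{C}^0_\theta$ for every positive diagonal matrix $D$. *)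

(* Defs.v *)
From HB Require Import structures.
From mathcomp Require Import all_boot all_order all_algebra.
From mathcomp Require Import complex.
From mathcomp Require Import reals trigo.
Set Implicit Arguments.
Unset Strict Implicit.
Unset Printing Implicit Defensive.
Import Order.TTheory GRing.Theory Num.Theory.
Local Open Scope ring_scope.

Definition principal_minor (R : comPzRingType) (n : nat) (A : 'M[R]_n)
    (S : {set 'I_n}) : R :=
  \det (mxsub (@enum_val _ (mem S)) (@enum_val _ (mem S)) A).

Definition P_matrix (R : numDomainType) (n : nat) (A : 'M[R]_n) : Prop :=
  forall S : {set 'I_n}, S != set0 -> 0 < principal_minor A S.

Definition Q_matrix (R : numDomainType) (n : nat) (A : 'M[R]_n) : Prop :=
  forall k : nat, (1 <= k <= n)%N ->
    0 < \sum_(S : {set 'I_n} | #|S| == k) principal_minor A S.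

Definition positive_diagonal (R : numDomainType) (n : nat) (D : 'M[R]_n) :
    Prop :=
  is_diag_mx D /\ forall i : 'I_n, 0 < D i i.

(* The region is only meant for 0 <= theta < pi / 2. The value at theta = 0 is
   a separate clause: the sector inequalities would give the empty set there. *)
Definition negative_sector (R : realType) (theta : R) (z : R[i]) : Prop :=
  if theta == 0 then complex.Re z < 0 /\ complex.Im z = 0
  else [/\ complex.Re z < 0, complex.Re z * tan theta < complex.Im z &
           complex.Im z < - complex.Re z * tan theta].

(* [eigenvalue] only sees eigenvalues in the base field, so the real matrix is
   first mapped to complex entries. *)
Definition relatively_D_stable (R : realType) (n : nat) (theta : R)
    (M : 'M[R]_n) : Prop :=
  forall D : 'M[R]_n, positive_diagonal D ->
  forall z : R[i], eigenvalue (map_mx (real_complex R) (D *m M)) z ->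
    negative_sector theta z.

(* Main.v *)
Require Import Defs.
From HB Require Import structures.
From mathcomp Require Import all_boot all_order all_algebra.
From mathcomp Require Import perm complex polyrcf.
From mathcomp Require boolp classical_sets.
From mathcomp Require Import reals trigo.
From mathcomp Require Import ring lra.
Set Implicit Arguments.
Unset Strict Implicit.
Unset Printing Implicit Defensive.
Import Order.TTheory GRing.Theory Num.Theory.
Local Open Scope ring_scope.

(* If z is an eigenvalue of -DA then -z^2 is a root of det(t + (DA)^2), whose
   coefficients are positive sums of principal minors of (DA)^2; such a
   polynomial of degree n has no root with |arg t| <= pi / n.  Hence no
   eigenvalue of DA is imaginary, and those in the right half-plane lie in the
   required sector.  That all of them lie in the right half-plane is shown by
   switching on the diagonal entries of D one at a time.  The eigenvalues move
   continuously without meeting the imaginary axis, and the one emerging from 0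
   starts to the right, because it is governed by a ratio of principal minors
   of A.  The limit matrices D >= 0 with zero entries are covered by letting
   D + e tend to D. *)

(** * Determinants expanded in principal minors *)

(** Sylvester's identity: one block matrix has two block triangular factorizations, with these two
    determinants. *)
Lemma det_add1_mulmxC (R : comPzRingType) (m n : nat) (X : 'M[R]_(m, n))
    (Y : 'M[R]_(n, m)) :
  \det (1%:M + X *m Y) = \det (1%:M + Y *m X).
Proof.
have E1 : block_mx 1%:M (- X) Y 1%:M =
    block_mx 1%:M 0 Y 1%:M *m block_mx 1%:M (- X) 0 (1%:M + Y *m X).
  rewrite mulmx_block !mulmx1 !mul1mx !mulmx0 ?mul0mx !addr0 ?add0r.
  by rewrite mulmxN addrCA addNr addr0.
have E2 : block_mx 1%:M (- X) Y 1%:M =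
    block_mx 1%:M (- X) 0 1%:M *m block_mx (1%:M + X *m Y) 0 Y 1%:M.
  rewrite mulmx_block !mulmx1 !mul1mx !mulmx0 ?mul0mx ?add0r.
  by rewrite mulNmx addrK.
have := congr1 determinant E1.
by rewrite E2 !det_mulmx !det_ublock !det_lblock !det1 !mul1r !mulr1.
Qed.

(** Keeping the size [n] for every [S] lets minors be handled row by row and through products with
    diagonal matrices. *)
Lemma principal_minorE (R : comPzRingType) (n : nat) (A : 'M[R]_n)
    (S : {set 'I_n}) :
  principal_minor A S =
  \det (\matrix_(i, j) (if i \in S then A i j else (i == j)%:R)).
Proof.
(* X Y keeps the rows of A - 1 indexed by S, and 1 + Y X is the submatrix. *)
pose f := @enum_val _ (mem S).
pose X : 'M[R]_(n, #|S|) := \matrix_(i, k) (i == f k)%:R.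
pose Y : 'M[R]_(#|S|, n) := \matrix_(k, j) (A (f k) j - (f k == j)%:R).
have -> : \matrix_(i, j) (if i \in S then A i j else (i == j)%:R) =
          1%:M + X *m Y.
  apply/matrixP => i j; rewrite !mxE; case: ifPn => iS.
    rewrite (bigD1 (enum_rank_in iS i)) //= big1 => [|k nk].
      by rewrite !mxE /f enum_rankK_in // eqxx mul1r addr0 addrC subrK.
    rewrite !mxE; case: eqVneq => [e|]; last by rewrite mul0r.
    by case/eqP: nk; apply: enum_val_inj; rewrite enum_rankK_in.
  rewrite big1 ?addr0 // => k _; rewrite !mxE; case: eqVneq => [e|].
    by case/negP: iS; rewrite e; exact: enum_valP.
  by rewrite mul0r.
rewrite det_add1_mulmxC; congr (\det _); apply/matrixP => k l; rewrite !mxE.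
rewrite (bigD1 (f l)) //= big1 => [|j nj].
  rewrite !mxE eqxx mulr1 addr0 /f (inj_eq enum_val_inj).
  by rewrite addrC subrK.
by rewrite !mxE (negPf nj) mulr0.
Qed.

Lemma principal_minor0 (R : comPzRingType) (n : nat) (A : 'M[R]_n) :
  principal_minor A set0 = 1.
Proof.
rewrite principal_minorE -[RHS](det1 _ n); congr (\det _).
by apply/matrixP => i j; rewrite !mxE inE.
Qed.

(** Multilinearity in the rows: each row of the sum is split in two, and [S] records the rows taken
    from [M]. *)
Lemma det_diag_add (R : comPzRingType) (n : nat) (x : 'rV[R]_n)
    (M : 'M[R]_n) :
  \det (diag_mx x + M) =
  \sum_(S : {set 'I_n}) (\prod_(i in ~: S) x 0 i) * principal_minor M S.
Proof.
rewrite /determinant.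
transitivity (\sum_(s : {perm 'I_n}) \sum_(S : {set 'I_n}) (-1) ^+ s *
    \prod_i (if i \in S then M i (s i) else x 0 i *+ (i == s i))).
  apply: eq_bigr => s _; rewrite -mulr_sumr -bigA_distr; congr (_ * _).
  by apply: eq_bigr => i _; rewrite !mxE addrC.
rewrite exchange_big /=; apply: eq_bigr => S _.
(* The product of [diag_mx y] and [N] has the rows of [M] on [S] and those of [diag_mx x]
   elsewhere. *)
pose y : 'rV[R]_n := \row_i (if i \in S then 1 else x 0 i).
pose N := \matrix_(i, j) (if i \in S then M i j else (i == j)%:R).
rewrite principal_minorE -/N.
have -> : \prod_(i in ~: S) x 0 i = \det (diag_mx y).
  rewrite det_diag big_mkcond; apply: eq_bigr => i _.
  by rewrite !mxE inE; case: (i \in S).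
rewrite -det_mulmx /determinant; apply: eq_bigr => s _; congr (_ * _).
apply: eq_bigr => i _; rewrite mul_diag_mx !mxE.
by case: ifP => _; rewrite ?mul1r // mulr_natr.
Qed.

Lemma principal_minor_diag_mul (R : comPzRingType) (n : nat) (d : 'rV[R]_n)
    (M : 'M[R]_n) (S : {set 'I_n}) :
  principal_minor (diag_mx d *m M) S =
  (\prod_(i in S) d 0 i) * principal_minor M S.
Proof.
pose y : 'rV[R]_n := \row_i (if i \in S then d 0 i else 1).
have -> : \prod_(i in S) d 0 i = \det (diag_mx y).
  by rewrite det_diag big_mkcond; apply: eq_bigr => i _; rewrite mxE.
rewrite !principal_minorE -det_mulmx; congr (\det _).
apply/matrixP => i j; rewrite !mul_diag_mx !mxE.
by case: ifP => _; rewrite ?mul1r // mul_diag_mx mxE.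
Qed.

Lemma principal_minor_map (R S : comPzRingType) (f : {rmorphism R -> S})
    (n : nat) (A : 'M[R]_n) (T : {set 'I_n}) :
  principal_minor (map_mx f A) T = f (principal_minor A T).
Proof.
rewrite /principal_minor -det_map_mx; congr (\det _).
by apply/matrixP => i j; rewrite !mxE.
Qed.

Lemma det_scalar_add (R : comPzRingType) (n : nat) (x : R) (M : 'M[R]_n) :
  \det (x%:M + M) = \sum_(k < n.+1)
    x ^+ (n - k) * \sum_(S : {set 'I_n} | #|S| == k) principal_minor M S.
Proof.
rewrite -diag_const_mx det_diag_add.
rewrite (partition_big (fun S : {set 'I_n} => inord #|S| : 'I_n.+1) xpredT) //=.
have cardS (S : {set 'I_n}) : (#|S| <= n)%N.
  by rewrite -[n in leqRHS]card_ord max_card.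
apply: eq_bigr => k _; rewrite mulr_sumr; apply: eq_big => S.
  by rewrite -val_eqE /= inordK // ltnS.
move=> /eqP <-; rewrite inordK ?ltnS //; congr (_ * _).
under eq_bigr do rewrite mxE.
by rewrite prodr_const cardsCs setCK card_ord.
Qed.

(** The empty set contributes [x ^+ n] and all other terms are nonnegative. Unlike mere positivity,
    this bound is independent of [M] and survives a limit. *)
Lemma det_scalar_add_Q (R : numDomainType) (n : nat) (x : R) (M : 'M[R]_n) :
  Q_matrix M -> 0 < x -> x ^+ n <= \det (x%:M + M).
Proof.
move=> QM x0; rewrite det_scalar_add big_ord_recl /= subn0.
rewrite (big_pred1 set0) => [|S]; last by rewrite cards_eq0.
rewrite principal_minor0 mulr1 lerDl sumr_ge0 // => k _.
by rewrite mulr_ge0 ?exprn_ge0 ?ltW // QM //= ltn_ord.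
Qed.

(** * Polynomials indexed by the subsets of a set *)

(* For g T = d_T A[T], with d supported on S, this is
   det(t + diag(d) A) / t ^ (n - #|S|), see det_diag_mul_subset_poly. *)
Definition subset_poly (R : nzRingType) (I : finType) (S : {set I})
    (g : {set I} -> R) : {poly R} :=
  \sum_(T : {set I} | T \subset S) g T *: 'X^(#|S| - #|T|).

Section SubsetPoly.
Variables (R : comNzRingType) (I : finType).
Implicit Types (S T : {set I}) (g : {set I} -> R).

Lemma eq_subset_poly S g h : (forall T, T \subset S -> g T = h T) ->
  subset_poly S g = subset_poly S h.
Proof. by move=> gh; apply: eq_bigr => T /gh ->. Qed.

Lemma subset_polyZ S g c :
  subset_poly S (fun T => c * g T) = c *: subset_poly S g.
Proof. by rewrite scaler_sumr; apply: eq_bigr => T _; rewrite scalerA. Qed.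

Lemma size_subset_poly S g : (size (subset_poly S g) <= #|S|.+1)%N.
Proof.
apply: (leq_trans (size_sum _ _ _)); apply/bigmax_leqP => T _.
by rewrite (leq_trans (size_scale_leq _ _)) // size_polyXn ltnS leq_subr.
Qed.

Lemma subset_poly_at0 S g : (subset_poly S g).[0] = g S.
Proof.
rewrite /subset_poly horner_sum (bigD1 S) //= big1 => [|T /andP[TS nTS]].
  by rewrite addr0 hornerZ subnn expr0 hornerC mulr1.
rewrite hornerZ hornerXn expr0n subn_eq0 leqNgt proper_card ?mulr0 //.
by rewrite properEneq nTS.
Qed.

(** The subsets are sorted by whether they contain [i]. For [g T = d_T A[T]] this shows that the
    polynomial is affine in [d_i]. *)
Lemma subset_poly_setU1 S g i : i \notin S ->
  subset_poly (i |: S) g =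
  'X * subset_poly S g + subset_poly S (fun T => g (i |: T)).
Proof.
move=> iS; rewrite /subset_poly (bigID (fun T : {set I} => i \notin T)) /=.
congr (_ + _).
  rewrite mulr_sumr; apply: eq_big => T; last first.
    move=> /andP[/subsetP TS iT]; rewrite -scalerAr -exprS cardsU1 iS add1n.
    rewrite subSn //; apply/subset_leq_card/subsetP => j jT.
    have := TS j jT; rewrite !inE; case: eqVneq => // e.
    by rewrite -e jT in iT.
  apply/andP/idP => [[TS iT]|TS]; last first.
    by rewrite (subset_trans TS) ?subsetU1 // (contra _ iS) // => /(subsetP TS).
  by rewrite -(setU1K iS) subsetD1 TS.
rewrite (reindex_onto (fun T => i |: T) (fun T => T :\ i)) /= => [|T]; last first.
  by rewrite negbK => /andP[_]; exact: setD1K.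
apply: eq_big => T.
  rewrite setU11 andbT; apply/andP/idP => [[TS /eqP <-]|TS].
    by rewrite -(setU1K iS) setSD.
  by rewrite setUS // setU1K // (contra _ iS) // => /(subsetP TS).
move=> /andP[_ /eqP eT]; have iT : i \notin T by rewrite -eT !inE eqxx.
by rewrite !cardsU1 iS iT subSS.
Qed.

Lemma subset_poly_monic S g : g set0 = 1 ->
  subset_poly S g \is monic /\ size (subset_poly S g) = #|S|.+1.
Proof.
move=> g0; elim: {S}_.+1 {-2}S (ltnSn #|S|) g g0 => // k IH S Sk g g0.
have [->|[i iS]] := set_0Vmem S.
  rewrite /subset_poly (big_pred1 set0) => [|T]; last by rewrite subset0.
  by rewrite g0 scale1r cards0 subn0 expr0 size_poly1 monic1.
have Sk' : (#|S :\ i| < k)%N by rewrite (cardsD1 i S) iS in Sk.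
have [m sz] := IH _ Sk' g g0.
have iSi : i \notin S :\ i by rewrite !inE eqxx.
have szX : size ('X * subset_poly (S :\ i) g) = (#|S :\ i|).+2.
  by rewrite -commr_polyX size_mulX ?sz // monic_neq0.
have lt_sz : (size (subset_poly (S :\ i) (fun T => g (i |: T))) <
              size ('X * subset_poly (S :\ i) g)%R)%N.
  by rewrite szX ltnS size_subset_poly.
rewrite -(setD1K iS) subset_poly_setU1 // cardsU1 iSi.
split; last by rewrite size_polyDl // szX.
by rewrite monicE lead_coefDl // -monicE monicMl ?monicX.
Qed.

End SubsetPoly.

(** A set not contained in [S] contributes a factor [d_i = 0]. What remains has the common factor
    [x ^+ (n - #|S|)], which accounts for the trivial eigenvalue 0. *)
Lemma det_diag_mul_subset_poly (R : comNzRingType) (n : nat) (A : 'M[R]_n)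
    (d : 'rV[R]_n) (S : {set 'I_n}) (x : R) :
  (forall i, i \notin S -> d 0 i = 0) ->
  \det (x%:M + diag_mx d *m A) = x ^+ (n - #|S|) *
    (subset_poly S
      (fun T => (\prod_(i in T) d 0 i) * principal_minor A T)).[x].
Proof.
have Sn : (#|S| <= n)%N by rewrite -[leqRHS]card_ord max_card.
move=> d0; rewrite -diag_const_mx det_diag_add horner_sum mulr_sumr.
rewrite (bigID (fun T : {set 'I_n} => T \subset S)) /= [X in _ + X]big1.
  rewrite addr0; apply: eq_bigr => T TS.
  under eq_bigr do rewrite mxE.
  rewrite prodr_const cardsCs setCK card_ord principal_minor_diag_mul.
  rewrite hornerZ hornerXn [RHS]mulrCA -exprD addnBA ?subset_leq_card //.
  by rewrite (subnK Sn) mulrC.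
move=> T /subsetPn[i iT iS].
by rewrite principal_minor_diag_mul (bigD1 i iT) /= d0 // !(mul0r, mulr0).
Qed.

(** * Passage to nonnegative diagonal matrices *)

Lemma poly_ge_at0 (R : rcfType) (p : {poly R}) (c : R) :
  (forall e, 0 < e -> c <= p.[e]) -> c <= p.[0].
Proof.
move=> cp; rewrite leNgt; apply/negP; rewrite -subr_gt0.
move=> /(poly_cont 0 p)[e e0 /(_ (e / 2))].
have e2 : 0 < e / 2 by rewrite divr_gt0.
rewrite subr0 gtr0_norm // gtr_pMr // invf_lt1 ?ltr1n // => /(_ isT).
apply/negP; rewrite -leNgt (le_trans _ (ler_norm _)) // lerD2r.
exact: cp.
Qed.

(** For [d + e] with [e > 0] the determinant is at least [x ^+ n]. It is a polynomial in [e], so the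
    bound persists at [e = 0]. *)
Lemma det_sqr_diag_mul_gt0 (R : realType) (n : nat) (A : 'M[R]_n)
    (QA : forall D : 'M[R]_n, positive_diagonal D -> Q_matrix ((D *m A) ^+ 2))
    (d : 'rV[R]_n) (x : R) :
  (forall i, 0 <= d 0 i) -> 0 < x ->
  0 < \det (x%:M + (diag_mx d *m A) *m (diag_mx d *m A)).
Proof.
move=> d0 x0.
pose N : 'M[{poly R}]_n := diag_mx (map_mx polyC d + const_mx 'X) *m map_mx polyC A.
pose p := \det ((x%:P)%:M + N *m N).
have pE e : p.[e] =
    \det (x%:M + (diag_mx (d + const_mx e) *m A) *m (diag_mx (d + const_mx e) *m A)).
  have NE : map_mx (horner_eval e) N = diag_mx (d + const_mx e) *m A.
    apply/matrixP => i j; rewrite mxE /N !mul_diag_mx !mxE /=.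
    by rewrite horner_evalE !hornerE.
  rewrite -horner_evalE -det_map_mx map_mxD map_scalar_mx map_mxM NE /=.
  by rewrite horner_evalE hornerC.
suff : x ^+ n <= p.[0].
  rewrite pE (_ : const_mx 0 = 0) ?addr0; last by apply/matrixP => i j; rewrite !mxE.
  by apply: lt_le_trans; rewrite exprn_gt0.
apply: poly_ge_at0 => e e0; rewrite pE.
apply: det_scalar_add_Q => //.
rewrite -[_ *m _ *m _]/((diag_mx (d + const_mx e) *m A) ^+ 2).
apply: QA; split; first exact: diag_mx_is_diag.
by move=> i; rewrite !mxE eqxx mulr1n ltr_wpDl.
Qed.

(** * Hurwitz polynomials on the closed right half-plane *)

Local Open Scope complex_scope.

Definition hurwitz (R : rcfType) (p : {poly R[i]}) : Prop :=
  forall z : R[i], root p z -> complex.Re z < 0.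

Lemma horner_norm_le (R : numDomainType) (p : {poly R}) (d : nat) (z : R) :
  (size p <= d.+1)%N ->
  `|p.[z]| <= (\sum_(i < d.+1) `|p`_i|) * (1 + `|z|) ^+ d.
Proof.
move=> sp; rewrite (horner_coef_wide _ sp) mulr_suml.
apply: le_trans (ler_norm_sum _ _ _) _; apply: ler_sum => i _.
rewrite normrM normrX ler_wpM2l //.
have z1 : 1 <= 1 + `|z| by rewrite lerDl.
apply: (@le_trans _ _ ((1 + `|z|) ^+ i)).
  by rewrite lerXn2r ?nnegrE ?addr_ge0 // lerDr.
by rewrite ler_weXn2l // -ltnS ltn_ord.
Qed.

Lemma Re_le_norm (R : rcfType) (z : R[i]) : (complex.Re z)%:C <= `|z|.
Proof. by rewrite (le_trans _ (normc_ge_Re z)) // lecR ler_norm. Qed.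

Lemma ReB (R : rcfType) (z w : R[i]) :
  complex.Re (z - w) = complex.Re z - complex.Re w.
Proof. by case: z w => [a b] [c d]. Qed.

(** With [e = - Re w], every such [z] has [|z - w| >= e], so [1 + |w|] is at most [(1 + |w|) / e]
    times [|z - w|]; the triangle inequality handles [|z|]. *)
Lemma left_half_plane_dist (R : rcfType) (w : R[i]) : complex.Re w < 0 ->
  exists2 K : R[i], 0 < K &
  forall z, 0 <= complex.Re z -> 1 + `|z| <= K * `|z - w|.
Proof.
move=> w0; pose e : R[i] := (- complex.Re w)%:C.
have e0 : 0 < e by rewrite ltcR oppr_gt0.
exists (1 + (1 + `|w|) / e) => [|z z0].
  by rewrite addr_gt0 // divr_gt0 // ltr_wpDr.
have le_e : e <= `|z - w|.
  by rewrite (le_trans _ (Re_le_norm _)) // lecR ReB lerDr.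
have le_z : `|z| <= `|z - w| + `|w| by rewrite -[z in `|z|](subrK w) ler_normD.
rewrite mulrDl mul1r; apply: (@le_trans _ _ (1 + (`|z - w| + `|w|))).
  by rewrite lerD2l.
rewrite addrCA lerD2l mulrAC -mulrA ler_peMr ?addr_ge0 //.
by rewrite ler_pdivlMr // mul1r.
Qed.

(** Each linear factor of [p] dominates [1 + |z|], so [p] dominates the power of [1 + |z|] that
    bounds [r]. *)
Lemma hurwitz_dominates (R : rcfType) (p r : {poly R[i]}) :
  hurwitz p -> p != 0 -> (size r <= size p)%N ->
  exists2 K : R, 0 < K &
  forall z, 0 <= complex.Re z -> `|r.[z]| <= K%:C * `|p.[z]|.
Proof.
move=> hp p0 sr; have [s ps] := closed_field_poly_normal p.
have hs w : w \in s -> complex.Re w < 0.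
  move=> ws; apply: hp; rewrite ps rootZ ?lead_coef_eq0 //.
  by rewrite root_prod_XsubC.
have [K K0 HK] : exists2 K : R[i], 0 < K & forall z, 0 <= complex.Re z ->
    (1 + `|z|) ^+ size s <= K * `|(\prod_(w <- s) ('X - w%:P)).[z]|.
  elim: s hs {ps} => [|w s IH] hs.
    by exists 1 => // z _; rewrite big_nil hornerC normr1 mul1r.
  have [|K K0 HK] := IH; first by move=> v vs; apply: hs; rewrite inE vs orbT.
  have [|L L0 HL] := left_half_plane_dist (w := w).
    by apply: hs; rewrite inE eqxx.
  exists (L * K) => [|z z0]; first exact: mulr_gt0.
  rewrite big_cons hornerM hornerXsubC normrM exprS mulrACA.
  by rewrite ler_pM ?exprn_ge0 ?addr_ge0 ?HK ?HL.
have sp : size p = (size s).+1.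
  by rewrite ps size_scale ?lead_coef_eq0 // size_prod_XsubC.
rewrite sp in sr.
pose M := \sum_(i < (size s).+1) `|r`_i|.
have M0 : 0 <= M by apply: sumr_ge0 => i _.
have l0 : 0 < `|lead_coef p| by rewrite normr_gt0 lead_coef_eq0.
(* [M + 1] instead of [M] keeps the constant positive when [r = 0]. *)
pose L : R[i] := (M + 1) * (K / `|lead_coef p|).
have L0 : 0 < L by rewrite mulr_gt0 ?divr_gt0 // ltr_wpDl.
have EL : (complex.Re L)%:C = L by rewrite RRe_real // gtr0_real.
exists (complex.Re L) => [|z z0]; first by rewrite -ltcR EL.
rewrite EL; apply: le_trans (horner_norm_le z sr) _; rewrite -/M.
rewrite /L -mulrA ler_pM ?exprn_ge0 ?addr_ge0 // ?lerDl //.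
rewrite ps hornerZ normrM lead_coefZ.
have /monicP -> : \prod_(w <- s) ('X - w%:P) \is monic.
  exact: monic_prod_XsubC.
by rewrite mulr1 -mulrA mulKf ?gt_eqF ?HK.
Qed.

(** Each factor satisfies [|z - w| >= Re z - Re w >= Re z]. The bound depends only on the degree,
    hence is uniform over a family of monic polynomials. *)
Lemma hurwitz_lower_bound (R : rcfType) (p : {poly R[i]}) (z : R[i]) :
  hurwitz p -> p \is monic -> 0 <= complex.Re z ->
  (complex.Re z)%:C ^+ (size p).-1 <= `|p.[z]|.
Proof.
move=> hp pm z0; have [s] := closed_field_poly_normal p.
rewrite (monicP pm) scale1r => ps.
have hs w : w \in s -> complex.Re w < 0.
  by move=> ws; apply: hp; rewrite ps root_prod_XsubC.
rewrite ps size_prod_XsubC /=; elim: s hs {ps} => [|w s IH] hs.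
  by rewrite big_nil hornerC normr1.
rewrite big_cons hornerM hornerXsubC normrM exprS.
rewrite ler_pM ?exprn_ge0 ?ler0c // ?IH //; last first.
  by move=> v vs; apply: hs; rewrite inE vs orbT.
rewrite (le_trans _ (Re_le_norm _)) // lecR ReB lerDl oppr_ge0 ltW //.
by apply: hs; rewrite inE eqxx.
Qed.

(** Multiplying by the conjugate of [w] gives [Re z * |w|^2 = - a * Re w]. *)
Lemma Re_mul_neg (R : rcfType) (z w : R[i]) (a : R) :
  0 < a -> 0 < complex.Re w -> z * w = - a%:C -> complex.Re z < 0.
Proof.
case: z w => [x y] [u v] a0 u0 [e1 e2]; rewrite /= in u0 *.
rewrite ltNge; apply/negP => x0.
have : 0 <= x * (u ^+ 2 + v ^+ 2) by rewrite mulr_ge0 ?addr_ge0 ?sqr_ge0.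
have -> : x * (u ^+ 2 + v ^+ 2) = u * (x * u - y * v) + v * (x * v + y * u).
  by ring.
by rewrite e1 e2 mulrN oppr0 mulr0 addr0 oppr_ge0 leNgt mulr_gt0.
Qed.

(** * Continuation of the Hurwitz property in one parameter *)

Section Continuation.
Import boolp classical_sets.
Variables (R : realType) (q r : {poly R[i]}) (a : R).
Hypotheses (q_monic : q \is monic) (q_hurwitz : hurwitz q).
Hypotheses (sz_r : (size r <= size q)%N).
Hypotheses (a_gt0 : 0 < a) (r0 : r.[0] = a%:C * q.[0]).
(** In the application [s] is the diagonal entry being switched on. At [s = 0] there is an extra
    root 0, and [r0] makes it move like [- s a]: roots here are eigenvalues of [-DA], so they go to
    the left. *)
Let F (s : R) := 'X * q + s%:C *: r.
Hypothesis F_im : forall s z, 0 < s -> root (F s) z -> complex.Re z != 0.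

Let sizeXq : size ('X * q) = (size q).+1.
Proof. by rewrite -commr_polyX size_mulX // monic_neq0. Qed.

Let size_sr s : (size (s%:C *: r) < size ('X * q)%R)%N.
Proof. by rewrite sizeXq ltnS (leq_trans (size_scale_leq _ _)). Qed.

Let size_F s : size (F s) = (size q).+1.
Proof. by rewrite size_polyDl // sizeXq. Qed.

Let F_monic s : F s \is monic.
Proof.
by rewrite monicE lead_coefDl // -monicE monicMl ?monicX.
Qed.

Let F_shift s t z : (F s).[z] = (F t).[z] + (s - t)%:C * r.[z].
Proof. by rewrite !hornerE rmorphB /=; ring. Qed.

(* With r - a q = 'X u, a root satisfies z (1 + s u(z) / q(z)) = - s a. *)
Let small_s : exists2 e : R, 0 < e & forall s, 0 < s < e -> hurwitz (F s).
Proof.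
have [u Eu] : exists u, r - a%:C *: q = u * ('X - 0%:P).
  by apply/factor_theorem; rewrite rootE !hornerE r0 subrr.
rewrite subr0 in Eu.
have size_u : (size u <= size q)%N.
  have [->|u0] := eqVneq u 0; first by rewrite size_poly0.
  rewrite -ltnS -size_mulX // -Eu leqW // (leq_trans (size_polyD _ _)) //.
  by rewrite geq_max sz_r size_polyN size_scale_leq.
have [K K0 HK] := hurwitz_dominates q_hurwitz (monic_neq0 q_monic) size_u.
(* [K] bounds [|u / q|] on the closed right half-plane, so [s < 1 / K] gives [|v| < 1] and
   [Re (1 + v) > 0]. *)
exists K^-1 => [|s /andP[s0 sK] z Fz]; first by rewrite invr_gt0.
rewrite ltNge; apply/negP => z0.
have qz : q.[z] != 0.
  by apply: contraL z0 => /q_hurwitz; rewrite ltNge.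
pose v := s%:C * (u.[z] / q.[z]).
have v1 : `|v| < 1.
  rewrite /v !normrM normfV (le_lt_trans (y := s%:C * K%:C)) //.
    rewrite [`|s%:C|]ger0_norm ?ler0c ?(ltW s0) // ler_pM2l ?ltcR //.
    by rewrite ler_pdivrMr ?normr_gt0 // HK.
  by rewrite -rmorphM ltcR -ltr_pdivlMr ?div1r.
have : complex.Re z < 0; last by rewrite ltNge z0.
apply: (@Re_mul_neg _ z (1 + v) (s * a)); first exact: mulr_gt0.
  have : complex.Re (- v) < 1.
    by rewrite -ltcR (le_lt_trans (Re_le_norm _)) // normrN.
  by case: (v) => x y /=; lra.
have Er : r = a%:C *: q + u * 'X by rewrite -Eu addrC subrK.
apply: (mulIf qz); move: Fz; rewrite rootE /F Er !hornerE => /eqP Fz.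
rewrite /v rmorphM /=; apply/eqP; rewrite -subr_eq0; apply/eqP.
by rewrite -[RHS]Fz; field.
Qed.

(* At the infimum t of the bad parameters, a Hurwitz F t would stay Hurwitz
   nearby by hurwitz_dominates, whereas a root of F t in the open right
   half-plane contradicts hurwitz_lower_bound for F (t - h) as h tends to 0. *)
Lemma hurwitz_continuation s : 0 < s -> hurwitz (F s).
Proof.
move=> s_gt0; apply: contrapT => Fs.
pose B := [set s | 0 < s /\ ~ hurwitz (F s)]%classic.
have [e e0 He] := small_s.
have lbB : lbound B 0 by move=> t [/ltW].
have infB : has_inf B by split; [exists s | exists 0].
pose t := inf B.
have et : e <= t.
  apply: lb_le_inf; first by exists s.
  move=> x [x0 Fx]; rewrite leNgt; apply/negP => xe; apply: Fx.
  by apply: He; rewrite x0.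
have t0 : 0 < t := lt_le_trans e0 et.
have below x : 0 < x < t -> hurwitz (F x).
  move=> /andP[x0 xt]; apply: contrapT => Fx.
  have : t <= x by apply: ge_inf => //; exists 0.
  by rewrite leNgt xt.
have [Ft|] := pselect (hurwitz (F t)).
  have [||K K0 HK] := hurwitz_dominates (r := r) Ft.
  - exact: monic_neq0 (F_monic t).
  - by rewrite size_F (leq_trans sz_r).
  (* A bad [x] in [[t, t + 1/K)]: at a root [z] of [F x] with [Re z >= 0],
     [|F_t(z)| = (x - t) |r(z)|] would be smaller than [|F_t(z)|]. *)
  have [|x [x0 Fx] xt] := inf_adherent (eps := K^-1) _ infB.
    by rewrite invr_gt0.
  have tx : t <= x by apply: ge_inf => //; exists 0.
  apply: Fx => z Fxz; rewrite ltNge; apply/negP => z0.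
  have Ftz : (F t).[z] != 0.
    by apply: contraL z0 => /Ft; rewrite ltNge.
  have E : (F t).[z] = - ((x - t)%:C * r.[z]).
    by apply/eqP; rewrite -addr_eq0 -F_shift.
  have : `|(F t).[z]| < `|(F t).[z]|; last by rewrite ltxx.
  rewrite {1}E normrN normrM ger0_norm ?ler0c ?subr_ge0 //.
  apply: (@le_lt_trans _ _ ((x - t)%:C * (K%:C * `|(F t).[z]|))).
    by rewrite ler_wpM2l ?ler0c ?subr_ge0 // HK.
  rewrite mulrA -rmorphM gtr_pMl ?normr_gt0 // ltcR.
  by rewrite -ltr_pdivlMr // div1r ltrBlDl.
apply=> z Ftz; rewrite ltNge; apply/negP => z_ge0.
have z0 : 0 < complex.Re z by rewrite lt_def z_ge0 andbT (F_im t0 Ftz).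
pose N := complex.Re `|r.[z]|.
have EN : N%:C = `|r.[z]| by rewrite RRe_real // normr_real.
have N0 : 0 <= N by rewrite -ler0c EN.
(* [size q] is the degree of every [F s], because of the extra factor ['X]. *)
pose m := size q; pose c := complex.Re z ^+ m.
have c0 : 0 < c by rewrite exprn_gt0.
(* The first bound keeps [t - h] positive; the second makes [|F_(t-h)(z)| = h |r(z)|] smaller than
   [c], with [N + 1] to avoid dividing by 0. *)
pose h := Num.min (t / 2) (c / (N + 1)).
have N1 : 0 < N + 1 by rewrite ltr_wpDl.
have h0 : 0 < h by rewrite lt_min !divr_gt0.
have ht : h < t.
  by rewrite (le_lt_trans (y := t / 2)) ?ge_min ?lexx // gtr_pMr // invf_lt1 ?ltr1n.
have hc : h * N < c.
  apply: (@le_lt_trans _ _ (c / (N + 1) * N)).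
    by rewrite ler_wpM2r // ge_min lexx orbT.
  by rewrite mulrAC -mulrA gtr_pMr // ltr_pdivrMr // mul1r ltrDl.
have Fh : hurwitz (F (t - h)) by apply: below; rewrite subr_gt0 ht gtrDl oppr_lt0.
have := hurwitz_lower_bound Fh (F_monic _) z_ge0.
rewrite size_F (F_shift _ t) (eqP Ftz) add0r normrM -EN.
have -> : t - h - t = - h by ring.
rewrite rmorphN normrN ger0_norm ?ler0c ?(ltW h0) //.
rewrite -rmorphXn -rmorphM lecR leNgt.
by rewrite hc.
Qed.

End Continuation.

(** * Eigenvalues of [-DA] lie in the left half-plane *)

Lemma det_add_mul_sub (R : comNzRingType) (n : nat) (x : R) (M : 'M[R]_n) :
  \det (x%:M + M) * \det ((- x)%:M + M) = \det ((- x ^+ 2)%:M + M *m M).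
Proof.
rewrite -det_mulmx; congr (\det _).
rewrite mulmxDl !mulmxDr !mul_scalar_mx mul_mx_scalar scale_scalar_mx.
by rewrite mulrN -expr2 scaleNr addrA -[_ + x *: M + _]addrA subrr addr0.
Qed.

Lemma Re_eq0_sqr (R : rcfType) (z : R[i]) : complex.Re z = 0 -> z != 0 ->
  exists2 y : R, 0 < y & - z ^+ 2 = y%:C.
Proof.
case: z => x y /= -> ; rewrite eq_complex /= eqxx /= => y0.
exists (y ^+ 2); first by rewrite exprn_even_gt0.
by apply/eqP; rewrite eq_complex /= ; apply/andP; split; apply/eqP; ring.
Qed.

Section Homotopy.
Variables (R : realType) (n : nat) (A : 'M[R]_n).
Hypothesis PA : P_matrix A.
Hypothesis QA :
  forall D : 'M[R]_n, positive_diagonal D -> Q_matrix ((D *m A) ^+ 2).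
Local Notation toC := (real_complex R).
Let g (d : 'rV[R]_n) (T : {set 'I_n}) : R :=
  (\prod_(i in T) d 0 i) * principal_minor A T.
Let G (d : 'rV[R]_n) (S : {set 'I_n}) : {poly R[i]} :=
  map_poly toC (subset_poly S (g d)).

Lemma principal_minor_gt0 (S : {set 'I_n}) : 0 < principal_minor A S.
Proof. by have [->|/PA//] := eqVneq S set0; rewrite principal_minor0. Qed.

Let g0 (d : 'rV[R]_n) : g d set0 = 1.
Proof. by rewrite /g big_set0 principal_minor0 mulr1. Qed.

Let g_gt0 (d : 'rV[R]_n) (S : {set 'I_n}) :
  (forall i, i \in S -> 0 < d 0 i) -> 0 < g d S.
Proof. by move=> d0; rewrite mulr_gt0 ?principal_minor_gt0 ?prodr_gt0. Qed.

Let det_G (d : 'rV[R]_n) (S : {set 'I_n}) z : (forall i, i \notin S -> d 0 i = 0) ->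
  \det (z%:M + map_mx toC (diag_mx d *m A)) = z ^+ (n - #|S|) * (G d S).[z].
Proof.
move=> d0; rewrite map_mxM map_diag_mx (@det_diag_mul_subset_poly _ _ _ _ S).
  rewrite /G /subset_poly rmorph_sum /=; congr (_ * _.[z]).
  apply: eq_bigr => T _; rewrite map_polyZ map_polyXn; congr (_ *: _).
  rewrite principal_minor_map /g rmorphM rmorph_prod; congr (_ * _).
  by apply: eq_bigr => i _; rewrite mxE.
by move=> i iS; rewrite mxE d0.
Qed.

(** The determinants at [z] and [- z] multiply to the one of [y + (DA)^2] with [y = - z^2 > 0],
    which is positive. *)
Lemma det_imaginary_neq0 (d : 'rV[R]_n) (z : R[i]) :
  (forall i, 0 <= d 0 i) -> complex.Re z = 0 -> z != 0 ->
  \det (z%:M + map_mx toC (diag_mx d *m A)) != 0.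
Proof.
move=> d0 z0 /(Re_eq0_sqr z0)[y y0 Ey].
suff : \det (z%:M + map_mx toC (diag_mx d *m A)) *
       \det ((- z)%:M + map_mx toC (diag_mx d *m A)) != 0.
  by rewrite mulf_eq0 => /norP[].
rewrite det_add_mul_sub Ey -map_mxM -map_scalar_mx -map_mxD det_map_mx.
by rewrite fmorph_eq0 gt_eqF // det_sqr_diag_mul_gt0.
Qed.

Let G_imaginary (d : 'rV[R]_n) (S : {set 'I_n}) z :
  (forall i, i \in S -> 0 < d 0 i) ->
  root (G d S) z -> complex.Re z != 0.
Proof.
move=> d0 Gz; apply/eqP => z0.
have [z00|nz] := eqVneq z 0.
  move: Gz; rewrite z00 rootE /G -[0]/(toC 0) horner_map subset_poly_at0.
  by rewrite fmorph_eq0 gt_eqF // g_gt0.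
(* [G d S] reads [d] only on [S]. Zeroing the other entries makes it a factor of a determinant with
   nonnegative diagonal. *)
pose d' : 'rV[R]_n := \row_i (if i \in S then d 0 i else 0).
have GE : G d S = G d' S.
  congr (map_poly _ _); apply: eq_subset_poly => T /subsetP TS; congr (_ * _).
  by apply: eq_bigr => i /TS iS; rewrite mxE iS.
have d'0 i : 0 <= d' 0 i by rewrite mxE; case: ifP => // /d0 /ltW.
have d'S i : i \notin S -> d' 0 i = 0 by rewrite mxE => /negPf ->.
have := det_imaginary_neq0 d'0 z0 nz.
by rewrite (det_G _ d'S) -GE (eqP Gz) mulr0 eqxx.
Qed.

(** Induction on [#|S|]: an index [i] is removed, and [d_i] becomes the continuation parameter. *)
Let hurwitz_G (d : 'rV[R]_n) (S : {set 'I_n}) :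
  (forall i, i \in S -> 0 < d 0 i) -> hurwitz (G d S).
Proof.
elim: {S}_.+1 {-2}S (ltnSn #|S|) => // k IH S Sk d0.
have [->|[i iS]] := set_0Vmem S.
  move=> z; rewrite /G /subset_poly (big_pred1 set0) => [|T]; last first.
    by rewrite subset0.
  rewrite g0 scale1r cards0 subn0 expr0 rmorph1 rootE hornerC.
  by rewrite oner_eq0.
pose U := S :\ i.
have iU : i \notin U by rewrite !inE eqxx.
have dU j : j \in U -> 0 < d 0 j by rewrite !inE => /andP[_ /d0].
have Uk : (#|U| < k)%N by rewrite (cardsD1 i S) iS in Sk.
pose q := subset_poly U (g d).
pose r := subset_poly U
  (fun T => (\prod_(j in T) d 0 j) * principal_minor A (i |: T)).
(* This is [r(0) / q(0)], since the products of [d] over [U] cancel; it is positive because [A] is a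
   P-matrix. *)
pose a := principal_minor A (i |: U) / principal_minor A U.
have [q_monic sz_q] := subset_poly_monic U (g0 d).
pose ds (s : R) : 'rV[R]_n := \row_j (if j == i then s else d 0 j).
have GE s : G (ds s) S = 'X * map_poly toC q + (toC s) *: map_poly toC r.
  rewrite /G -(setD1K iS) subset_poly_setU1 // rmorphD rmorphM /= map_polyX.
  rewrite -map_polyZ -subset_polyZ; congr (_ + _).
    congr (_ * _); congr (map_poly _ _).
    apply: eq_subset_poly => T /subsetP TU; congr (_ * _).
    apply: eq_bigr => j /TU jU; rewrite mxE; case: eqP => // e.
    by rewrite -e jU in iU.
  congr (map_poly _ _); apply: eq_subset_poly => T /subsetP TU.
  have iT : i \notin T by apply: contra iU => /TU.
  rewrite /g big_setU1 //= mxE eqxx mulrA; congr (_ * _ * _).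
  apply: eq_bigr => j jT; rewrite mxE; case: eqP => // e.
  by rewrite -e jT in iT.
have -> : d = ds (d 0 i).
  by apply/rowP => j; rewrite mxE; case: eqP => [->|].
rewrite GE; apply: (@hurwitz_continuation _ _ _ a); last exact: d0.
- by rewrite map_monic.
- exact: IH.
- by rewrite !size_map_poly sz_q size_subset_poly.
- by rewrite divr_gt0 ?principal_minor_gt0.
- rewrite -[0]/(toC 0) !horner_map -rmorphM; congr (toC _).
  rewrite !subset_poly_at0 /g /a mulrCA divfK // gt_eqF //.
  exact: principal_minor_gt0.
- move=> s z s0; rewrite -GE; apply: G_imaginary => j jS; rewrite mxE.
  by case: eqP => // _; exact: d0.
Qed.

Lemma root_det_Re_lt0 (d : 'rV[R]_n) (z : R[i]) : (forall i, 0 < d 0 i) ->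
  \det (z%:M + map_mx toC (diag_mx d *m A)) = 0 -> complex.Re z < 0.
Proof.
move=> d0; rewrite (@det_G _ setT) => [|i]; last by rewrite inE.
rewrite cardsT card_ord subnn expr0 mul1r => Gz.
by apply: (@hurwitz_G d setT) => //; rewrite rootE Gz.
Qed.

End Homotopy.

(** * Arguments and the sector *)

Lemma complex_expi_X (R : realType) (x : R) (k : nat) :
  (cos x +i* sin x) ^+ k = cos (x *+ k) +i* sin (x *+ k).
Proof.
elim: k => [|k IH]; first by rewrite expr0 mulr0n cos0 sin0.
rewrite exprS IH mulrS cosD sinD; apply/eqP; rewrite eq_complex /= eqxx.
by rewrite addrC [sin x * _]mulrC eqxx.
Qed.

(* Every term has imaginary part [>= 0], and the one of degree 1 has [> 0]. *)
Lemma pos_coef_sector_neq0 (R : realType) (n : nat) (c : nat -> R)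
    (rho psi : R) :
  (1 < n)%N -> (forall k, (k <= n)%N -> 0 < c k) -> 0 < rho ->
  0 < psi <= pi / n%:R ->
  \sum_(k < n.+1) (rho%:C * (cos psi +i* sin psi)) ^+ (n - k) * (c k)%:C != 0.
Proof.
move=> n1 c0 rho0 /andP[psi0 psi_le].
have n0 : 0 < n%:R :> R by rewrite ltr0n ltnW.
have npsi : psi *+ n <= pi by rewrite -mulr_natr -ler_pdivlMr.
have ImD : {morph (@complex.Im R : R[i] -> R) : z w / z + w} by case=> ? ? [].
apply/eqP => /(congr1 (@complex.Im R)); apply/eqP.
rewrite (big_morph _ ImD (id1 := 0)) //.
have ImE k : complex.Im ((rho%:C * (cos psi +i* sin psi)) ^+ (n - k) * (c k)%:C)
    = rho ^+ (n - k) * sin (psi *+ (n - k)) * c k.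
  by rewrite exprMn -rmorphXn complex_expi_X /=; ring.
have term_ge0 (k : 'I_n.+1) :
    0 <= rho ^+ (n - k) * sin (psi *+ (n - k)) * c k.
  have ck : 0 < c k by rewrite c0 // -ltnS ltn_ord.
  rewrite !mulr_ge0 ?exprn_ge0 ?(ltW rho0) ?(ltW ck) //.
  apply: sin_ge0_pi; rewrite mulrn_wge0 ?(ltW psi0) //=.
  rewrite (le_trans _ npsi) // -[leLHS]mulr_natr -[leRHS]mulr_natr.
  by rewrite ler_wpM2l ?(ltW psi0) // ler_nat leq_subr.
under eq_bigr do rewrite ImE.
(* The index [n - 1] carries the first power. Its sine is positive because [n > 1] gives
   [psi <= pi / n < pi]. *)
have n1' : (n.-1 < n.+1)%N by rewrite ltnS leq_pred.
rewrite gt_eqF // (bigD1 (Ordinal n1')) //= ltr_pwDl ?sumr_ge0 //.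
have -> : (n - n.-1 = 1)%N by case: (n) n1 => // m _; rewrite subSnn.
rewrite !mulr_gt0 ?exprn_gt0 ?c0 ?leq_pred // sin_gt0_pi // mulr1n psi0 /=.
apply: (le_lt_trans psi_le); rewrite ltr_pdivrMr // ltr_pMr ?pi_gt0 //.
by rewrite ltr1n.
Qed.

(** Writing [z = |z| e^(i (pi - phi))] gives [- z^2 = |z|^2 e^(i (pi - 2 phi))]. On or above the
    upper edge of the sector [theta <= phi < pi / 2], and [pi - 2 theta = pi / n]. *)
Lemma sqr_polar (R : realType) (n : nat) (z : R[i]) : (1 < n)%N ->
  complex.Re z < 0 ->
  - complex.Re z * tan (pi / 2 - pi / (2 * n%:R)) <= complex.Im z ->
  exists rho psi : R, [/\ 0 < rho, 0 < psi <= pi / n%:R &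
    - z ^+ 2 = rho%:C * (cos psi +i* sin psi)].
Proof.
case: z => x y /= n1 x0; set theta := _ - _ => y_ge.
have n0 : 0 < n%:R :> R by rewrite ltr0n ltnW.
have nx0 : 0 < - x by rewrite oppr_gt0.
have pi0 := pi_gt0 R.
have pin : 0 < pi / (2 * n%:R) :> R by rewrite divr_gt0 ?mulr_gt0.
have pin2 : pi / (2 * n%:R) <= pi / 2 :> R.
  by rewrite invfM mulrA ler_pdivrMr // ler_peMr ?divr_ge0 ?(ltW pi0) // ler1n ltnW.
pose phi := atan (y / - x).
have theta_phi : theta <= phi.
  rewrite -[theta]tanK; last first.
    by rewrite in_itv /= /theta; apply/andP; split; lra.
  by apply: le_atan; rewrite ler_pdivlMr // mulrC.
have phi_lt : phi < pi / 2 by exact: atan_ltpi2.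
have cphi : 0 < cos phi by apply: cos_gt0_pihalf; rewrite atan_gtNpi2 atan_ltpi2.
have tphi : sin phi = (y / - x) * cos phi.
  by rewrite -(atanK (y / - x)) -/phi /tan divfK // gt_eqF.
(* The modulus is [|z|^2], since [- x = |z| cos phi]. *)
exists (x ^+ 2 / cos phi ^+ 2), (pi - phi *+ 2); split.
- by apply: divr_gt0; [rewrite exprn_even_gt0 //= lt_eqF | exact: exprn_gt0].
- have -> : pi / n%:R = pi - theta *+ 2 :> R.
    by rewrite /theta; field; rewrite gt_eqF.
  by apply/andP; split; rewrite ?mulr2n; lra.
have -> : cos (pi - phi *+ 2) = sin phi ^+ 2 - cos phi ^+ 2.
  by rewrite addrC cosDpi cosN cos_mulr2n sin2cos2; ring.
have -> : sin (pi - phi *+ 2) = (cos phi * sin phi) *+ 2.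
  by rewrite addrC sinDpi sinN opprK sin_mulr2n.
have x_neq0 : x != 0 by rewrite lt_eqF.
have c_neq0 : cos phi != 0 by rewrite gt_eqF.
apply/eqP; rewrite eq_complex tphi /=; apply/andP.
by split; apply/eqP; field; rewrite ?x_neq0 ?c_neq0.
Qed.

(** * Conclusion for [-A] *)

Lemma Q_matrix_det_sum (R : realType) (n : nat) (M : 'M[R]_n) (t : R[i]) :
  Q_matrix M -> exists2 c : nat -> R, forall k, (k <= n)%N -> 0 < c k &
  \det (t%:M + map_mx (real_complex R) M) =
  \sum_(k < n.+1) t ^+ (n - k) * (c k)%:C.
Proof.
move=> QM.
exists (fun k => \sum_(S : {set 'I_n} | #|S| == k) principal_minor M S).
  (* Order 0 is outside the Q-matrix condition; its coefficient is the empty minor 1. *)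
  move=> k kn; have [->|k0] := posnP k; last by rewrite QM ?k0.
  rewrite (big_pred1 set0) => [|S]; last by rewrite cards_eq0.
  by rewrite principal_minor0.
rewrite det_scalar_add; apply: eq_bigr => k _; rewrite rmorph_sum.
by congr (_ * _); apply: eq_bigr => S _; rewrite principal_minor_map.
Qed.

Theorem theorem11 (R : realType) (n : nat) (n_gt0 : (0 < n)%N) (A : 'M[R]_n)
    (PA : P_matrix A)
    (QA : forall D : 'M[R]_n, positive_diagonal D -> Q_matrix ((D *m A) ^+ 2)) :
  relatively_D_stable (pi / 2 - pi / (2 * n%:R)) (- A).
Proof.
move=> D Dpos z /eigenvalueP[v vz v0].
have [/diag_mxP[d Dd] D0] := Dpos.
have d0 i : 0 < d 0 i by have := D0 i; rewrite Dd mxE eqxx.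
pose M := map_mx (real_complex R) (D *m A).
have detz : \det (z%:M + M) = 0.
  apply/eqP/det0P; exists v => //; rewrite mulmxDr mul_mx_scalar.
  move: vz; rewrite mulmxN map_mxN mulmxN -/M => /(canRL (@opprK _)) ->.
  by rewrite subrr.
have Re_lt0 w : \det (w%:M + M) = 0 -> complex.Re w < 0.
  by rewrite /M Dd; exact: (root_det_Re_lt0 PA).
have det_sqr w : \det (w%:M + M) = 0 ->
    \det ((- w ^+ 2)%:M + map_mx (real_complex R) ((D *m A) ^+ 2)) = 0.
  by move=> detw; rewrite expr2 map_mxM -/M -det_add_mul_sub detw mul0r.
have z_lt0 := Re_lt0 z detz; rewrite /negative_sector.
(* For [n = 1] the angle is 0 and [z] must be real: the imaginary part of [- z^2 c_0 + c_1 = 0] is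
   [- 2 x y c_0], with [x < 0]. *)
have [n1|n1] := leqP n 1.
  have En : n = 1%N by apply/eqP; rewrite eqn_leq n1.
  rewrite {1}En mulr1 subrr eqxx; split=> //.
  have [c c0] := Q_matrix_det_sum (- z ^+ 2) (QA D Dpos).
  have c0_gt0 : 0 < c 0%N by exact: c0.
  rewrite det_sqr // En !big_ord_recl big_ord0 /= subn0 subnn.
  rewrite expr1 expr0 mul1r addr0.
  move=> /(congr1 (@complex.Im R)) /=; case: (z) z_lt0 => x y /= x0.
  rewrite mulr0 add0r addr0 mulNr => /esym/eqP.
  rewrite oppr_eq0 mulf_eq0 (gt_eqF c0_gt0) orbF [y * x]mulrC -mulr2n.
  by rewrite mulrn_eq0 mulf_eq0 (lt_eqF x0) => /eqP.
have upper w : \det (w%:M + M) = 0 ->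
    complex.Im w < - complex.Re w * tan (pi / 2 - pi / (2 * n%:R)).
  move=> detw; rewrite ltNge; apply/negP.
  move=> /(sqr_polar n1 (Re_lt0 _ detw))[rho [psi [rho0 psiI Ew]]].
  have [c c0 detE] := Q_matrix_det_sum (- w ^+ 2) (QA D Dpos).
  have := pos_coef_sector_neq0 n1 c0 rho0 psiI.
  by rewrite -Ew -detE det_sqr // eqxx.
(* [M] is real, so the upper edge applied to the conjugate of [z] gives the lower edge for [z]. *)
have det_conj : \det (z^*%:M + M) = 0.
  have -> : M = map_mx conjc M by apply/matrixP => i j; rewrite !mxE conjc_real.
  by rewrite -map_scalar_mx -map_mxD det_map_mx detz rmorph0.
(* For [n > 1] the angle is nonzero, which selects the clause with the sector inequalities. *)
have pin : pi / (2 * n%:R) < pi / 2 :> R.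
  rewrite ltr_pM2l ?pi_gt0 // ltf_pV2 ?posrE ?mulr_gt0 ?ltr0n //.
  by rewrite ltr_pMr // ltr1n.
rewrite subr_eq0 gt_eqF //; split=> //; last exact: upper.
have := upper _ det_conj; case: (z) => x y /=.
by rewrite ltrNl mulNr opprK.
Qed.
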